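(* Let $(\mathfrak g,H,\mathcal G_g)$ be a solvable generalised Riemannian Lie algebra, $\delta\in E^*=(\mathfrak g\oplus\mathfrak g^* )^*$ and $\mathfrak g'=[\mathfrak g,\mathfrak g]$. Then $(\mathfrak g,H,\mathcal G_g,\delta)$ is generalised Einstein if and only if $H=0$, $\mathfrak g'$ is an Abelian ideal, $\mathfrak h:=(\mathfrak g')^\perp$ is an Abelian subalgebra, $\mathfrak h$ acts skew-symmetrically on $\mathfrak g'$, and $\delta(\mathfrak g'\oplus(\mathfrak g')^\flat)=0$. Equivalently, $(\mathfrak g,H,\mathcal G_g,\delta)$ is generalised Einstein if and only if $H=0$, $g$ is flat and $\delta(\mathfrak g'\oplus(\mathfrak g')^\flat)=0$.
   Context: Let $\mathfrak g$ be a finite-dimensional real Lie algebra. A generalised pseudo-Riemannian metric on $\mathfrak g$ is a pair $(H,\mathcal G_g)$ where $H\in\Lambda^3\mathfrak g^*$ is closed for the Chevalley–Eilenberg differential (normalised by $d\alpha(X,Y)=-\alpha([X,Y])$), $g$ is a non-degenerate symmetric bilinear form on $\mathfrak g$, and $\mathcal G_g$ is the endomorphism of $E=\mathfrak g\oplus\mathfrak g^*$ given by $\mathcal G_g(X+\xi)=\xi^\sharp+X^\flat$, with $X^\flat=g(X,\cdot)$ and $\sharp=\flat^{-1}$; then $(\mathfrak g,H,\mathcal G_g)$ is called a generalised pseudo-Riemannian Lie algebra, and a generalised Riemannian Lie algebra if $g$ is positive definite. Let $E_\pm=\{X\pm X^\flat\mid X\in\mathfrak g\}$ be the $\pm1$-eigenspaces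 of $\mathcal G_g$ and $\pi_\pm=\frac12(\mathrm{id}\pm\mathcal G_g):E\to E_\pm$. The $H$-twisted Dorfman bracket on $E$ is $[X+\xi,Y+\eta]_H=[X,Y]+d\eta(X,\cdot)-d\xi(Y,\cdot)+H(X,Y,\cdot)$. A divergence operator is an element $\delta\in E^*$. For $u\in E_+$, $v\in E_-$ put $\Gamma_u=\pi_+\circ[u,\cdot]_H|_{E_-}:E_-\to E_+$ and $\Gamma_v=\pi_-\circ[v,\cdot]_H|_{E_+}:E_+\to E_-$. The generalised Ricci curvatures of $(\mathcal G_g,\delta)$ are, by a known result taken here as definition, $\mathcal{RC}^+(v,u)=-\mathrm{tr}(\Gamma_v\circ\Gamma_u)+\delta(\pi_+[v,u]_H)$ and $\mathcal{RC}^-(u,v)=-\mathrm{tr}(\Gamma_v\circ\Gamma_u)+\delta(\pi_-[u,v]_H)$. The quadruple $(\mathfrak g,H,\mathcal G_g,\delta)$ is generalised Einstein if $\mathcal{RC}^+=0$ and $\mathcal{RC}^-=0$ (for all $u\in E_+$, $v\in E_-$). ''$\mathfrak h$ acts skew-symmetrically on $\mathfrak g'$'' means $\mathrm{ad}_X|_{\mathfrak g'}$ is $g$-skew-symmetric for all $X\in\mathfrak h$. ''$g$ is flat'' means that the left-invariant metric defined by $g$ on a Lie group with Lie algebra $\mathfrak g$ has vanishing Riemann curvature. *)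

(* Defs.v *)
From HB Require Import structures.
From mathcomp Require Import all_boot all_order all_algebra reals.
From mathcomp Require Import ring lra.

Set Implicit Arguments.
Unset Strict Implicit.
Unset Printing Implicit Defensive.

Import Order.TTheory GRing.Theory Num.Theory.
Local Open Scope ring_scope.

HB.mixin Record isLieAlgebra (R : fieldType) L of Vector R L := {
  lie : L -> L -> L;
  lie_linearl_subproof : forall y, linear (lie^~ y);
  lie_linearr_subproof : forall x, linear (lie x);
  liexx : forall x, lie x x = 0;
  lie_jacobi : forall x y z,
    lie x (lie y z) + lie y (lie z x) + lie z (lie x y) = 0
}.

#[short(type="lieAlgebraType")]
HB.structure Definition LieAlgebra (R : fieldType) :=
  { L of Vector R L & isLieAlgebra R L }.

Notation "{[ x , y ]}" := (lie x y)
  (at level 0, x at level 99, y at level 99, format "{[ x ,  y ]}") : ring_scope.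

Notation dual R V := 'Hom(V, (R : fieldType)^o).

Section Trace.
Variables (R : fieldType) (V : vectType R).

Definition lftrace (f : 'End(V)) : R :=
  \sum_i coord (vbasis {:V}) i (f (vbasis {:V})`_i).

Lemma lftrace_basis n (e : n.-tuple V) (f : 'End(V)) :
  basis_of {:V} e -> lftrace f = \sum_i coord e i (f e`_i).
Proof.
move=> eV; have bV := vbasisP {:V}; rewrite /lftrace; symmetry.
under eq_bigr => i _ do
  rewrite {1}(coord_basis bV (memvf e`_i)) linear_sum linear_sum /=.
rewrite exchange_big /=; apply: eq_bigr => j _.
rewrite [in RHS](coord_basis eV (memvf (f (vbasis {:V})`_j))) linear_sum /=.
by apply: eq_bigr => i _; rewrite !linearZ /= mulrC.
Qed.

End Trace.

Section LieTheory.
Variables (R : fieldType) (L : lieAlgebraType R).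
Implicit Types (x y z : L) (U W : {vspace L}).

Lemma lie_bilinear : bilinear_for
  (GRing.Scale.Law.clone _ _ *:%R _) (GRing.Scale.Law.clone _ _ *:%R _)
  (@lie R L).
Proof.
by split=> [y|x]; [exact: lie_linearl_subproof | exact: lie_linearr_subproof].
Qed.
HB.instance Definition _ :=
  bilinear_isBilinear.Build R L L L _ _ (@lie R L) lie_bilinear.

Lemma lieC x y : {[x, y]} = - {[y, x]}.
Proof.
have := liexx (x + y); rewrite linearDl !linearDr /= !liexx add0r addr0.
by move/eqP; rewrite addr_eq0 => /eqP.
Qed.

(* The linear span of all brackets {[x, y]} with x \in U and y \in W
   (see lieVP), in the style of prodv. *)
Definition lieV U W : {vspace L} :=
  <<[seq {[x, y]} | x <- vbasis U, y <- vbasis W]>>%VS.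

Lemma mem_lieV U W x y : x \in U -> y \in W -> {[x, y]} \in lieV U W.
Proof.
move=> /coord_vbasis-> /coord_vbasis->.
rewrite linear_sumlz; apply: memv_suml => i _.
rewrite linear_sumr; apply: memv_suml => j _.
rewrite linearZlr /= !memvZ // memv_span //.
by apply: allpairs_f; apply: mem_nth; rewrite size_tuple.
Qed.

Lemma lieVP U W (A : {vspace L}) :
  reflect (forall x y, x \in U -> y \in W -> {[x, y]} \in A)
          (lieV U W <= A)%VS.
Proof.
apply: (iffP idP) => [sA x y xU yW|sA].
  by apply: (subvP sA); apply: mem_lieV.
apply/span_subvP => _ /allpairsP[[x y] /= [xU yW ->]].
by apply: sA; apply: vbasis_mem.
Qed.

Definition derived_algebra : {vspace L} := lieV fullv fullv.

Definition derived_series n : {vspace L} := iter n (fun U => lieV U U) fullv.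

Definition lie_solvable : Prop := exists n, derived_series n = 0%VS.

Definition lie_abelian U : Prop := {in U &, forall x y, {[x, y]} = 0}.

Definition lie_subalgebra U : Prop := {in U &, forall x y, {[x, y]} \in U}.

Definition lie_ideal U : Prop := forall x, {in U, forall y, {[x, y]} \in U}.

(* Elements of the third exterior power of the dual of L. *)
Record threeForm := ThreeForm {
  threeform_fun :> L -> L -> L -> R;
  threeform_linear1 : forall y z, scalar (fun x => threeform_fun x y z);
  threeform_linear2 : forall x z, scalar (fun y => threeform_fun x y z);
  threeform_linear3 : forall x y, scalar (threeform_fun x y);
  threeform_alt12 : forall x z, threeform_fun x x z = 0;
  threeform_alt23 : forall x y, threeform_fun x y y = 0;
  threeform_alt13 : forall x y, threeform_fun x y x = 0
}.

(* The Chevalley-Eilenberg differential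
     (d w)(x_0, .., x_k) =
       \sum_(i < j) (-1)^(i+j) w([x_i, x_j], x_0, .., ^x_i, .., ^x_j, .., x_k)
   in degrees one and three. *)
Definition ce_d1 (a : dual R L) x y : R := - a {[x, y]}.

Definition ce_d3 (H : threeForm) x0 x1 x2 x3 : R :=
  - H {[x0, x1]} x2 x3 + H {[x0, x2]} x1 x3 - H {[x0, x3]} x1 x2
  - H {[x1, x2]} x0 x3 + H {[x1, x3]} x0 x2 - H {[x2, x3]} x0 x1.

Definition ce_closed (H : threeForm) : Prop :=
  forall x0 x1 x2 x3, ce_d3 H x0 x1 x2 x3 = 0.

Lemma ce_d1_linear (a : dual R L) x : scalar (ce_d1 a x).
Proof. by move=> k y z; rewrite /ce_d1 linearPr linearP opprD mulrN. Qed.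
HB.instance Definition _ a x :=
  GRing.isLinear.Build R L R^o *%R (ce_d1 a x) (ce_d1_linear a x).

HB.instance Definition _ (H : threeForm) x y :=
  GRing.isLinear.Build R L R^o *%R (H x y) (threeform_linear3 H x y).

(* The 1-forms d a(x, .) and H(x, y, .). *)
Definition contract_d1 (a : dual R L) x : dual R L := linfun (ce_d1 a x : L -> R^o).

Definition contract_H (H : threeForm) x y : dual R L := linfun (H x y : L -> R^o).

Definition courant : vectType R := (L * dual R L)%type.

Definition dorfman (H : threeForm) (a b : courant) : courant :=
  ({[a.1, b.1]},
   contract_d1 b.2 a.1 - contract_d1 a.2 b.1 + contract_H H a.1 b.1).

Lemma dorfman_linearr (H : threeForm) a : linear (dorfman H a).
Proof.
move=> k b c; rewrite /dorfman /=; apply/eqP; rewrite xpair_eqE /= linearPr eqxx.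
apply/eqP/lfunP=> z; rewrite !(add_lfunE, scale_lfunE, opp_lfunE, lfunE) /=.
rewrite /ce_d1 !(add_lfunE, scale_lfunE) linearPl [a.2 (_ + _)]linearP threeform_linear2 /=.
rewrite /GRing.scale /=; ring.
Qed.

End LieTheory.

Section GeneralisedMetric.
Variables (R : realType) (L : lieAlgebraType R).
Variables (H : threeForm L) (g : {symmetric L}).
Implicit Types (x y z : L) (U : {vspace L}).

Local Notation E := (courant L).

Definition positive_definite : Prop := forall x, x != 0 -> 0 < g x x.

Definition generalised_pseudo_riemannian : Prop :=
  ce_closed H /\ nondegenerate g.

Definition generalised_riemannian : Prop :=
  generalised_pseudo_riemannian /\ positive_definite.

Definition gflat_fun x : dual R L := linfun (g x : L -> R^o).

Lemma gflat_fun_linear : linear gflat_fun.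
Proof.
move=> a x y; apply/lfunP=> z; rewrite lfunE.
by rewrite /= linearPl add_lfunE scale_lfunE !lfunE.
Qed.
HB.instance Definition _ :=
  GRing.isLinear.Build R L (dual R L) _ gflat_fun gflat_fun_linear.

Definition gflat : 'Hom(L, dual R L) := linfun gflat_fun.

Lemma gflatE x y : gflat x y = g x y.
Proof. by rewrite lfunE /= lfunE. Qed.

(* (_^-1)%VF is a two-sided inverse of gflat when g is nondegenerate
   (gflatK and gsharpK). *)
Definition gsharp : 'Hom(dual R L, L) := (gflat^-1)%VF.

Lemma gflat_ker0 : nondegenerate g -> lker gflat == 0%VS.
Proof.
move=> /eqP g_nd; rewrite -subv0 -g_nd; apply/subvP => x.
rewrite memv_ker => /eqP gx0; apply/mem_orthovP => y _.
by rewrite -gflatE gx0 lfunE.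
Qed.

Lemma gflatK : nondegenerate g -> cancel gflat gsharp.
Proof. by move=> /gflat_ker0/lker0_lfunK. Qed.

Lemma gsharpK : nondegenerate g -> cancel gsharp gflat.
Proof.
move=> /gflat_ker0 ker0 a; apply: limg_lfunVK.
suff -> : limg gflat = fullv by exact: memvf.
apply/eqP; rewrite eqEdim subvf /=.
have := limg_ker_dim gflat fullv; rewrite (eqP ker0) capv0 dimv0 add0n => ->.
by rewrite !dimvf /= /dim /= muln1.
Qed.

Definition gmetric_fun (a : E) : E := (gsharp a.2, gflat a.1).

Lemma gmetric_fun_linear : linear gmetric_fun.
Proof. by move=> k a b; rewrite /gmetric_fun !linearP. Qed.
HB.instance Definition _ :=
  GRing.isLinear.Build R E E _ gmetric_fun gmetric_fun_linear.

Definition gmetric : 'End(E) := linfun gmetric_fun.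

Definition embp_fun x : E := (x, gflat x).
Definition embm_fun x : E := (x, - gflat x).

Lemma embp_fun_linear : linear embp_fun.
Proof. by move=> k x y; rewrite /embp_fun linearP. Qed.
HB.instance Definition _ :=
  GRing.isLinear.Build R L E _ embp_fun embp_fun_linear.

Lemma embm_fun_linear : linear embm_fun.
Proof. by move=> k x y; rewrite /embm_fun linearP opprD -scalerN. Qed.
HB.instance Definition _ :=
  GRing.isLinear.Build R L E _ embm_fun embm_fun_linear.

Definition Eplus : {vspace E} := limg (linfun embp_fun).
Definition Eminus : {vspace E} := limg (linfun embm_fun).

Lemma gmetricE a : gmetric a = (gsharp a.2, gflat a.1).
Proof. by rewrite lfunE. Qed.

(* Eplus and Eminus are the eigenspaces of gmetric for 1 and -1. *)
Lemma EplusP a :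
  nondegenerate g -> reflect (gmetric a = a) (a \in Eplus).
Proof.
move=> g_nd; apply: (iffP idP) => [/memv_imgP[x _ ->]|].
  by rewrite gmetricE lfunE /= gflatK.
move=> /(congr1 fst); rewrite gmetricE /= => Da.
apply/memv_imgP; exists a.1; rewrite ?memvf // lfunE /= /embp_fun.
by rewrite -[X in gflat X]Da gsharpK //; case: (a).
Qed.

Lemma EminusP a :
  nondegenerate g -> reflect (gmetric a = - a) (a \in Eminus).
Proof.
move=> g_nd; apply: (iffP idP) => [/memv_imgP[x _ ->]|].
  rewrite gmetricE lfunE /= linearN /= gflatK //.
  by congr pair; rewrite /= opprK.
move=> /(congr1 fst); rewrite gmetricE /= => Da.
apply/memv_imgP; exists a.1; rewrite ?memvf // lfunE /= /embm_fun.
have -> : - gflat a.1 = a.2 by rewrite -linearN /= -[- a.1]Da gsharpK.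
by case: (a).
Qed.

Definition proj_plus : 'End(E) := 2^-1 *: (\1 + gmetric)%VF.
Definition proj_minus : 'End(E) := 2^-1 *: (\1 - gmetric)%VF.

Lemma gmetricK : nondegenerate g -> involutive gmetric.
Proof.
by move=> g_nd [x a]; rewrite !gmetricE /= gflatK // gsharpK.
Qed.

Lemma proj_plus_mem a : nondegenerate g -> proj_plus a \in Eplus.
Proof.
move=> g_nd; apply/EplusP => //.
rewrite scale_lfunE add_lfunE id_lfunE linearZ linearD /= gmetricK //.
by rewrite addrC.
Qed.

Lemma proj_minus_mem a : nondegenerate g -> proj_minus a \in Eminus.
Proof.
move=> g_nd; apply/EminusP => //.
rewrite scale_lfunE add_lfunE opp_lfunE id_lfunE linearZ linearB /= gmetricK //.
by rewrite -scalerN opprB.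
Qed.

(* Corestrictions of proj_plus and proj_minus, whose values lie in Eplus and
   Eminus when g is nondegenerate. *)
Definition pi_plus (a : E) : subvs_of Eplus := vsproj Eplus (proj_plus a).
Definition pi_minus (a : E) : subvs_of Eminus := vsproj Eminus (proj_minus a).

Definition Gamma_plus_fun (u : subvs_of Eplus) (w : subvs_of Eminus) :
    subvs_of Eplus :=
  pi_plus (dorfman H (vsval u) (vsval w)).

Definition Gamma_minus_fun (v : subvs_of Eminus) (w : subvs_of Eplus) :
    subvs_of Eminus :=
  pi_minus (dorfman H (vsval v) (vsval w)).

Lemma Gamma_plus_fun_linear u : linear (Gamma_plus_fun u).
Proof.
move=> k v w; rewrite /Gamma_plus_fun /pi_plus.
by rewrite linearP dorfman_linearr !linearP.
Qed.
HB.instance Definition _ u :=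
  GRing.isLinear.Build R (subvs_of Eminus) (subvs_of Eplus) _
    (Gamma_plus_fun u) (Gamma_plus_fun_linear u).

Lemma Gamma_minus_fun_linear v : linear (Gamma_minus_fun v).
Proof.
move=> k u w; rewrite /Gamma_minus_fun /pi_minus.
by rewrite linearP dorfman_linearr !linearP.
Qed.
HB.instance Definition _ v :=
  GRing.isLinear.Build R (subvs_of Eplus) (subvs_of Eminus) _
    (Gamma_minus_fun v) (Gamma_minus_fun_linear v).

Definition Gamma_plus u : 'Hom(subvs_of Eminus, subvs_of Eplus) :=
  linfun (Gamma_plus_fun u).

Definition Gamma_minus v : 'Hom(subvs_of Eplus, subvs_of Eminus) :=
  linfun (Gamma_minus_fun v).

Definition ricci_plus (delta : dual R E)
    (v : subvs_of Eminus) (u : subvs_of Eplus) : R :=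
  - lftrace (Gamma_minus v \o Gamma_plus u)%VF
  + delta (vsval (pi_plus (dorfman H (vsval v) (vsval u)))).

Definition ricci_minus (delta : dual R E)
    (u : subvs_of Eplus) (v : subvs_of Eminus) : R :=
  - lftrace (Gamma_minus v \o Gamma_plus u)%VF
  + delta (vsval (pi_minus (dorfman H (vsval u) (vsval v)))).

Definition generalised_einstein (delta : dual R E) : Prop :=
  (forall v u, ricci_plus delta v u = 0) /\
  (forall u v, ricci_minus delta u v = 0).

Definition acts_skew U (W : {vspace L}) : Prop :=
  {in U, forall x, {in W &, forall y z, g {[x, y]} z = - g y {[x, z]}}}.

(* The Levi-Civita connection of the left-invariant metric g on left-invariant
   fields, by the Koszul formula
     2 g(nabla_x y, z) = g([x, y], z) - g([y, z], x) + g([z, x], y);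
   it is the unique metric, torsion-free connection (levi_civitaP). *)
Definition koszul x y z : R :=
  2^-1 * (g {[x, y]} z - g {[y, z]} x + g {[z, x]} y).

Lemma koszul_linear x y : scalar (koszul x y).
Proof.
move=> k z t; rewrite /koszul !(linearPr, linearPl) /=; ring.
Qed.
HB.instance Definition _ x y :=
  GRing.isLinear.Build R L R^o *%R (koszul x y) (koszul_linear x y).

Definition levi_civita x y : L := gsharp (linfun (koszul x y : L -> R^o)).

Lemma levi_civitaP (D : L -> L -> L) : nondegenerate g ->
  (forall x y, D x y - D y x = {[x, y]}) /\
    (forall x y z, g (D x y) z + g y (D x z) = 0) <->
  (forall x y, D x y = levi_civita x y).
Proof.
move=> g_nd; have gC x y : g x y = g y x by rewrite hermC /= expr0 mul1r.
have lcE x y z : g (levi_civita x y) z = koszul x y z.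
  by rewrite -gflatE gsharpK // lfunE.
have aux1 (p q r s t u : R) : t + s = 0 -> r + q = 0 -> p + u = 0 ->
    p = 2^-1 * (p - q - (r - s) + (t - u)) by lra.
have aux2 (p q r : R) :
  2^-1 * (p - q + r) - 2^-1 * (- p - - r + - q) = p by lra.
have aux3 (p q r : R) :
  2^-1 * (p - q + r) + 2^-1 * (- r - - q + - p) = 0 by lra.
split=> [[tf met] x y|DE].
  apply: (can_inj (gflatK g_nd)); apply/lfunP => z; rewrite !gflatE lcE.
  rewrite /koszul -!tf !linearBl.
  have := met x y z; have := met y z x; have := met z x y.
  rewrite ![g y (D _ _)]gC ![g z (D _ _)]gC ![g x (D _ _)]gC.
  exact: aux1.
split=> x y; rewrite !DE.
  apply: (can_inj (gflatK g_nd)); apply/lfunP => z.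
  rewrite !gflatE linearBl /= !lcE /koszul.
  rewrite [{[y, x]}]lieC [{[x, z]}]lieC [{[z, y]}]lieC !linearNl.
  exact: aux2.
move=> z; rewrite DE [g y _]gC !lcE /koszul.
rewrite [{[x, z]}]lieC [{[z, y]}]lieC [{[y, x]}]lieC !linearNl.
exact: aux3.
Qed.

Definition curvature x y z : L :=
  levi_civita x (levi_civita y z) - levi_civita y (levi_civita x z)
  - levi_civita {[x, y]} z.

Definition flat_metric : Prop := forall x y z, curvature x y z = 0.

End GeneralisedMetric.

(* Main.v *)
(* Write nabla for the Levi-Civita connection and nabla^+-_x y = nabla_x y +-
   H(x, y, .)^sharp / 2, and for z, v in L put
     T(z, v) = tr (x |-> nabla^-_(nabla^+_x z) v).
   The two Ricci curvatures at (z, v) are - T(z, v) plus delta evaluated at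
   nabla^+_v z in E_+, respectively at nabla^-_z v in E_-. Hence an Einstein
   structure satisfies T(z, z) = 0 whenever nabla_z z = 0; a flat metric with
   H = 0 satisfies this as well, because then A = (x |-> nabla_x z) is such that
   A^2 = [A, nabla_z].

   This weaker condition suffices. Let D_k be the derived series and w in D_k
   be orthogonal to D_(k+1). Inductively the elements of the complement of D_k
   act skewly on D_k, which gives nabla_w w = 0 and shows that
   A = (x |-> nabla_x w) maps L to D_k and is symmetric on D_k. With
   h = H(., w, .)^sharp one finds T(w, w) = tr A^2 - tr h^2 / 4, where both
   terms are nonnegative. So h = 0 and A vanishes on D_k, that is, ad w is skew
   on D_k. As D_k reaches 0, this gives H = 0. The algebra D_1 is abelian
   because, if D_(k+2) = 0 with k > 0, then D_k is spanned modulo D_(k+1) by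
   brackets x = [p, q] with [q, x] = 0 and ad x skew on D_k; then
   tr (ad x)^2 = tr ([ad p, ad q] ad x) = 0, so that ad x = 0 on D_k and
   D_(k+1) = 0.

   Conversely the algebraic conditions give nabla_x y = [x_h, y], x_h being the
   component of x in the complement of D_1, whence flatness and T = 0. *)

Require Import Defs.
From HB Require Import structures.
From mathcomp Require Import all_boot all_order all_algebra reals.
From mathcomp Require Import ring lra.

Set Implicit Arguments.
Unset Strict Implicit.
Unset Printing Implicit Defensive.

Import Order.TTheory GRing.Theory Num.Theory.
Local Open Scope ring_scope.

(** * Traces *)

Section TraceTheory.
Variable R : fieldType.
Implicit Types V W : vectType R.

Lemma lftrace_is_scalar V : scalar (@lftrace R V).
Proof.
move=> k f h; rewrite /lftrace mulr_sumr -big_split; apply: eq_bigr => i _ /=.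
by rewrite add_lfunE scale_lfunE linearP.
Qed.
HB.instance Definition _ V :=
  GRing.isLinear.Build R 'End(V) R^o *%R (@lftrace R V) (@lftrace_is_scalar V).

Lemma lftraceC V W (f : 'Hom(V, W)) (h : 'Hom(W, V)) :
  lftrace (f \o h)%VF = lftrace (h \o f)%VF.
Proof.
have bV := vbasisP {:V}; have bW := vbasisP {:W}; rewrite /lftrace.
under eq_bigr => i _ do rewrite comp_lfunE {1}(coord_basis bV (memvf (h _)))
  linear_sum linear_sum /=.
rewrite exchange_big; apply: eq_bigr => j _ /=.
rewrite comp_lfunE [in RHS](coord_basis bW (memvf (f _))) !linear_sum /=.
by apply: eq_bigr => i _; rewrite !linearZ /= mulrC.
Qed.

End TraceTheory.

(** * Positive definite forms *)

Section Euclidean.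
Variables (R : realFieldType) (V : vectType R) (g : {symmetric V}).
Hypothesis g_pos : forall x, x != 0 -> 0 < g x x.
Implicit Types (x y : V) (U : {vspace V}) (A S : 'End(V)).

Lemma symm_formC x y : g x y = g y x.
Proof. by rewrite hermC /= expr0 mul1r. Qed.

Lemma form_ge0 x : 0 <= g x x.
Proof. by have [->|/g_pos/ltW//] := eqVneq x 0; rewrite linear0l. Qed.

Lemma form_eq0 x : g x x = 0 -> x = 0.
Proof.
by move=> gx0; apply/eqP/contraT => /g_pos; rewrite gx0 ltxx.
Qed.

Lemma form_inj x y : (forall z, g x z = g y z) -> x = y.
Proof.
move=> gE; apply/eqP; rewrite -subr_eq0; apply/eqP/form_eq0.
by rewrite linearBl /= gE subrr.
Qed.

Lemma mem_orthov_form U x y : x \in orthov g U -> y \in U -> g x y = 0.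
Proof. by move=> /mem_orthovP; apply. Qed.

(** Gram-Schmidt by induction on the dimension: a nonzero [v] in [U] is split off, [U] meeting its
    orthogonal hyperplane in one dimension less. Vectors are not normalised, so no square roots
    arise. *)
Lemma orthogonal_basis U : exists e : (\dim U).-tuple V,
  basis_of U e /\ forall i j : 'I_(\dim U), i != j -> g e`_i e`_j = 0.
Proof.
move Dn: (\dim U) => n; elim: n => [|n IHn] in U Dn *.
  exists [tuple]; split=> [|[]//].
  by rewrite basisEdim Dn leqnn andbT; move/eqP: Dn;
    rewrite dimv_eq0 => /eqP->; apply: sub0v.
pose v := vpick U; have vU : v \in U by apply: memv_pick.
have v0 : v != 0 by rewrite vpick0 -dimv_eq0 Dn.
have gv : g v v != 0 by rewrite gt_eqF ?g_pos.
pose W := (U :&: orthov g <[v]>)%VS.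
have DW : \dim W = n.
  rewrite -eq_dim_orthov1 ?Dn //; apply/mem_orthovPn; exists v => //.
have [e [eW oe]] := IHn W DW; exists [tuple of v :: e].
have oW i : (i < n)%N -> g v e`_i = 0.
  move=> lt_in; have : e`_i \in W by apply: (basis_mem eW);
    rewrite mem_nth ?size_tuple.
  by rewrite memv_cap mem_orthov1 symm_formC => /andP[_ /eqP].
split; last first.
  case=> [[|i] ltin] [[|j] ltjn] //= neq_ij; rewrite ?oW //; last first.
    by rewrite (oe (Ordinal (ltin : (i < n)%N)) (Ordinal (ltjn : (j < n)%N))).
  by rewrite symm_formC oW.
rewrite basisEdim /= size_tuple Dn ltnSn andbT; apply/subvP => x xU.
rewrite span_cons (span_basis eW) -(subrK ((g x v / g v v) *: v) x) addrC.
rewrite memv_add ?memvZ ?memv_line // memv_cap rpredB ?memvZ //= mem_orthov1.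
by rewrite linearBl linearZl /= divfK ?subrr.
Qed.

Lemma orthovDr U : (U + orthov g U = fullv)%VS.
Proof.
apply/vspaceP => x; rewrite memvf.
have [e [eU oe]] := orthogonal_basis U.
have eiU (i : 'I_(\dim U)) :
  e`_i \in U by rewrite (basis_mem eU) ?mem_nth ?size_tuple.
pose u := \sum_(i < \dim U) (g x e`_i / g e`_i e`_i) *: e`_i.
rewrite -(subrK u x) addrC memv_add //; first by apply: memv_suml => i _;
  apply: memvZ.
apply/mem_orthovP => y; rewrite -{1}(span_basis eU) => /coord_span->.
rewrite linear_sumr big1 // => j _ /=; rewrite linearZr linearBl /= /u.
rewrite linear_sumlz (bigD1 j) //= big1 => [|i neq_ij]; last first.
  by rewrite linearZl /= (oe _ _ neq_ij) mulr0.
rewrite linearZl /= addr0 divfK ?subrr ?mulr0 // gt_eqF // g_pos //.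
by rewrite (free_not0 (basis_free eU)) ?mem_nth ?size_tuple.
Qed.

Lemma orthov_cap U : (U :&: orthov g U = 0)%VS.
Proof.
apply/eqP; rewrite -subv0; apply/subvP => x; rewrite memv_cap => /andP[xU xo].
by rewrite memv0; apply/eqP/form_eq0/(mem_orthov_form xo).
Qed.

Definition orthproj U : 'End(V) := daddv_pi U (orthov g U).

Lemma orthproj_mem U x : orthproj U x \in U. Proof. exact: memv_pi. Qed.

Lemma orthproj_id U x : x \in U -> orthproj U x = x.
Proof. exact/daddv_pi_id/orthov_cap. Qed.

Lemma orthprojC_mem U x : x - orthproj U x \in orthov g U.
Proof.
have xf : x \in (U + orthov g U)%VS by rewrite orthovDr memvf.
by rewrite -{1}(daddv_pi_add (orthov_cap U) xf) addrC addKr memv_pi.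
Qed.

Lemma orthov_split U x :
  exists u w, [/\ u \in U, w \in orthov g U & x = u + w].
Proof.
exists (orthproj U x), (x - orthproj U x).
by rewrite orthproj_mem orthprojC_mem addrC subrK.
Qed.

Lemma orthovK U : orthov g (orthov g U) = U.
Proof.
apply/vspaceP => x; apply/idP/idP => [xoo|xU]; last first.
  by apply/mem_orthovP => v vU; rewrite symm_formC (mem_orthov_form vU).
have [u [v [uU vU xE]]] := orthov_split U x.
have := mem_orthov_form xoo vU; rewrite xE linearDl /= symm_formC.
by rewrite (mem_orthov_form vU uU) add0r => /form_eq0->; rewrite addr0.
Qed.

Lemma orthproj_form U x y : y \in U -> g (orthproj U x) y = g x y.
Proof.
move=> yU; apply/eqP; rewrite eq_sym -subr_eq0 -linearBl /=.
by rewrite (mem_orthov_form (orthprojC_mem U x)).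
Qed.

Lemma lftrace_orthogonal (e : (\dim {:V}).-tuple V) (f : 'End(V)) :
    basis_of {:V} e ->
    (forall i j : 'I_(\dim {:V}), i != j -> g e`_i e`_j = 0) ->
  lftrace f = \sum_(i < \dim {:V}) g (f e`_i) e`_i / g e`_i e`_i.
Proof.
move=> eV oe; rewrite (lftrace_basis f eV); apply: eq_bigr => i _.
rewrite [in RHS](coord_basis eV (memvf (f e`_i))) linear_sumlz /=.
rewrite (bigD1 i) //= big1 => [|j /oe e0]; last by rewrite linearZl /= e0 mulr0.
rewrite addr0 linearZl /= mulfK // gt_eqF // g_pos //.
by rewrite (free_not0 (basis_free eV)) ?mem_nth ?size_tuple.
Qed.

(** In an orthogonal basis the trace is the sum of the [g (A e_i) (A e_i) / g e_i e_i], a squared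
    Hilbert-Schmidt norm. *)
Lemma lftrace_adjoint A S : (forall x y, g (A x) y = g x (S y)) ->
  0 <= lftrace (S \o A)%VF /\ (lftrace (S \o A)%VF = 0 -> A = 0).
Proof.
move=> adjA; have [e [eV oe]] := orthogonal_basis {:V}.
have trE : lftrace (S \o A)%VF =
  \sum_(i < \dim {:V}) g (A e`_i) (A e`_i) / g e`_i e`_i.
  rewrite (lftrace_orthogonal _ eV oe); apply: eq_bigr => i _.
  by rewrite comp_lfunE symm_formC -adjA.
have pos i : 0 <= g (A e`_i) (A e`_i) / g e`_i e`_i by rewrite divr_ge0
  ?form_ge0.
rewrite trE; split=> [|/eqP]; first exact: sumr_ge0.
rewrite psumr_eq0 // => /allP A0; apply/lfunP => x; rewrite zero_lfunE.
rewrite (coord_basis eV (memvf x)) linear_sum big1 // => i _ /=.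
rewrite linearZ /=; have /= := A0 i (mem_index_enum i).
rewrite mulf_eq0 invr_eq0 => /orP[] /eqP/form_eq0-> ; first exact: scaler0.
by rewrite linear0 scaler0.
Qed.

(* If A maps into U and P is the orthogonal projection to U, then A = P A, so
   A^2 and (A P)^2 have the same trace; and A P is its own adjoint up to k. *)
Lemma lftrace_sqr U A k : (forall x, A x \in U) ->
    {in U &, forall x y, g (A x) y = k * g x (A y)} ->
  0 <= k * lftrace (A \o A)%VF /\
  (lftrace (A \o A)%VF = 0 -> {in U, forall x, A x = 0}).
Proof.
move=> AU Ak; pose S := (A \o orthproj U)%VF.
have -> : lftrace (A \o A)%VF = lftrace (S \o S)%VF.
  have {1}-> : (A = orthproj U \o A)%VF.
    by apply/lfunP=> x; rewrite comp_lfunE orthproj_id.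
  rewrite -comp_lfunA lftraceC; congr lftrace.
  apply/lfunP=> x; rewrite /S !comp_lfunE; congr (A _).
  by rewrite [RHS]orthproj_id.
have adjS x y : g (S x) y = g x ((k *: S)%VF y).
  rewrite scale_lfunE !comp_lfunE linearZr /= symm_formC.
  rewrite -[LHS](orthproj_form _ (AU _)) symm_formC Ak ?orthproj_mem //.
  by rewrite orthproj_form.
have [] := lftrace_adjoint adjS.
rewrite -comp_lfunZl linearZ /= => ge0 S0; split=> // tr0 x xU.
have /S0/lfunP/(_ x) : k * lftrace (S \o S)%VF = 0 by rewrite tr0 mulr0.
by rewrite comp_lfunE zero_lfunE orthproj_id.
Qed.

End Euclidean.

(** * Lie algebras *)

Lemma alternating_skew (R : pzRingType) (V : lmodType R) (f : V -> V -> R) :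
    (forall y, scalar (f^~ y)) -> (forall x, scalar (f x)) ->
  (forall x, f x x = 0) -> forall x y, f x y = - f y x.
Proof.
move=> lin1 lin2 fxx x y; have := fxx (1 *: x + y).
rewrite lin1 !(lin2 _ 1 x y) /= !fxx !mul1r add0r addr0 => /eqP.
by rewrite addr_eq0 => /eqP.
Qed.

Section LieAlgebras.
Variables (R : fieldType) (L : lieAlgebraType R).
Implicit Types (x y z : L) (U W : {vspace L}).

HB.instance Definition _ x :=
  GRing.isLinear.Build R L L *:%R (lie x) (lie_linearr_subproof x).

Definition ad x : 'End(L) := linfun (lie x).

Lemma adE x y : ad x y = {[x, y]}. Proof. exact: lfunE. Qed.

Lemma lie_jacobi_ad x y z : {[{[x, y]}, z]} = {[x, {[y, z]}]} - {[y, {[x, z]}]}.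
Proof.
have /eqP := lie_jacobi x y z.
by rewrite [{[z, {[x, y]}]}]lieC [{[z, x]}]lieC linearNr subr_eq0 => /eqP <-.
Qed.

Lemma lie_idealV U : lie_ideal U -> lie_ideal (lieV U U).
Proof.
move=> idU x y; suff /subvP sUU : (lieV U U <= ad x @^-1: lieV U U)%VS.
  by move=> /sUU; rewrite -memv_preim adE.
apply/lieVP => a b aU bU; rewrite -memv_preim adE.
have -> : {[x, {[a, b]}]} = {[{[x, a]}, b]} + {[a, {[x, b]}]}.
  by rewrite lie_jacobi_ad subrK.
by rewrite rpredD ?mem_lieV ?idU.
Qed.

Local Notation D := (derived_series L).

Lemma derived_series_ideal k : lie_ideal (D k).
Proof.
elim: k => [|k IHk]; last exact: lie_idealV.
by move=> x y _; exact: memvf.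
Qed.

Lemma derived_series_subS k : (D k.+1 <= D k)%VS.
Proof. by apply/lieVP => x y _ yD; apply: derived_series_ideal. Qed.

Lemma mem_derived_seriesS k x y : x \in D k -> y \in D k -> {[x, y]} \in D k.+1.
Proof. exact: mem_lieV. Qed.

End LieAlgebras.

(** * Metric connections with torsion *)

Section Connections.
Variables (R : realType) (L : lieAlgebraType R).
Variables (H : threeForm L) (g : {symmetric L}).
Hypothesis g_pos : positive_definite g.
Implicit Types (x y z u v w : L) (c : R).

Lemma threeformC12 x y z : H x y z = - H y x z.
Proof.
apply: (@alternating_skew _ _ (fun x y => H x y z)) => [u|u|u].
- exact: threeform_linear1.
- exact: threeform_linear2.
- exact: threeform_alt12.
Qed.

Lemma threeformC13 x y z : H x y z = - H z y x.
Proof.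
apply: (@alternating_skew _ _ (fun x z => H x y z)) => [u|u|u].
- exact: threeform_linear1.
- exact: threeform_linear3.
- exact: threeform_alt13.
Qed.

Lemma pos_nondegenerate : nondegenerate g.
Proof.
rewrite /nondegenerate -subv0; apply/subvP => x xo.
by rewrite memv0; apply/eqP/(form_eq0 g_pos)/(mem_orthov_form xo)/memvf.
Qed.

Lemma gsharpE (a : dual R L) x : g (gsharp g a) x = a x.
Proof. by rewrite -gflatE gsharpK ?pos_nondegenerate. Qed.

Lemma levi_civitaE x y z : g (levi_civita g x y) z = koszul g x y z.
Proof. by rewrite gsharpE lfunE. Qed.

Lemma levi_civita_torsionfree x y :
  levi_civita g x y - levi_civita g y x = {[x, y]}.
Proof.
by have [_ /(_ (fun _ _ => erefl))[]] :=
  levi_civitaP (levi_civita g) pos_nondegenerate.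
Qed.

Lemma levi_civita_metric x y z :
  g (levi_civita g x y) z = - g y (levi_civita g x z).
Proof.
have [_ /(_ (fun _ _ => erefl))[_ met]] :=
  levi_civitaP (levi_civita g) pos_nondegenerate.
by apply/eqP; rewrite -addr_eq0 met.
Qed.

(* For c = 1/2 and c = -1/2 these are the two metric connections with skew
   torsion H and -H; for c = 0 this is the Levi-Civita connection. *)
Definition bismut c x y : L :=
  levi_civita g x y + c *: gsharp g (contract_H H x y).

Lemma bismutE c x y z : g (bismut c x y) z = koszul g x y z + c * H x y z.
Proof. by rewrite linearDl linearZl /= levi_civitaE gsharpE lfunE. Qed.

Definition bismut_diff_fun c y x := bismut c x y.

Lemma bismut_diff_fun_linear c y : linear (bismut_diff_fun c y).
Proof.
move=> k u v; apply: (form_inj g_pos) => z.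
rewrite bismutE linearPl /= !bismutE threeform_linear1 /koszul /=.
by rewrite !(linearPr, linearPl) /=; ring.
Qed.
HB.instance Definition _ c y :=
  GRing.isLinear.Build R L L *:%R (bismut_diff_fun c y)
    (bismut_diff_fun_linear c y).

Definition bismut_diff c y : 'End(L) := linfun (bismut_diff_fun c y).

Lemma bismut_diffE c y x : bismut_diff c y x = bismut c x y.
Proof. exact: lfunE. Qed.
Definition ricci_trace z v : R :=
  lftrace (bismut_diff (- 2^-1) v \o bismut_diff 2^-1 z)%VF.

(* The operator x |-> H(x, z, .)^sharp. *)
Definition torsion_op z : 'End(L) := bismut_diff 1 z - bismut_diff 0 z.

Lemma torsion_opE z x y : g (torsion_op z x) y = H x z y.
Proof.
rewrite add_lfunE opp_lfunE !bismut_diffE linearBl /= !bismutE; ring.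
Qed.

Lemma bismut_diff_split c z :
  bismut_diff c z = bismut_diff 0 z + c *: torsion_op z.
Proof.
apply/lfunP => x; apply: (form_inj g_pos) => y.
rewrite add_lfunE scale_lfunE linearDl linearZl /= torsion_opE.
by rewrite !bismut_diffE !bismutE; ring.
Qed.

Lemma levi_civita_diffE z x : bismut_diff 0 z x = levi_civita g x z.
Proof. by rewrite bismut_diffE /bismut scale0r addr0. Qed.

(** In [(A - h/2)(A + h/2)] the two cross terms have opposite traces by cyclicity. *)
Lemma ricci_trace_diag z :
  ricci_trace z z = lftrace (bismut_diff 0 z \o bismut_diff 0 z)%VF
                    - 4^-1 * lftrace (torsion_op z \o torsion_op z)%VF.
Proof.
rewrite /ricci_trace (bismut_diff_split 2^-1) (bismut_diff_split (- 2^-1)).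
move: (bismut_diff 0 z) (torsion_op z) => A h.
rewrite comp_lfunDl !comp_lfunDr -!comp_lfunZl -!comp_lfunZr !linearD /=.
by rewrite scalerA !linearZ /= [lftrace (h \o A)%VF]lftraceC; field.
Qed.

(* The only consequence of the Einstein equations needed for the structure
   theorem; it involves neither delta nor the curvatures off the diagonal. *)
Definition geodesic_null : Prop :=
  forall z, levi_civita g z z = 0 -> ricci_trace z z = 0.

(** Here [y] ranges over all of [L]. If [U] is an ideal and [y] is orthogonal to it, the left side
    vanishes, so the condition also makes [{[v, y]}] orthogonal to [U]. *)
Definition skew_to (U : {vspace L}) : Prop :=
  {in orthov g U, forall v, {in U, forall z, forall y,
     g {[v, z]} y = - g z {[v, y]}}}.

(* x |-> nabla_x w maps L into U and is symmetric on U, hence the trace of its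
   square is nonnegative, as is the one of - torsion_op w ^ 2. *)
Lemma geodesic_null_skew U w : geodesic_null ->
    lie_ideal U -> skew_to U -> w \in U -> w \in orthov g (lieV U U) ->
  {in U &, forall x y, g {[w, x]} y = - g x {[w, y]}} /\
  (forall x y, H w x y = 0).
Proof.
move=> gnull idU skU wU wU'.
have wperp x y : x \in U -> y \in U -> g {[x, y]} w = 0.
  by move=> xU yU; rewrite symm_formC (mem_orthov_form wU') ?mem_lieV.
(* By Koszul, [g (nabla_w w) z] equals [g {[z, w]} w]. It vanishes for [z] in [U] by the choice of
   [w], and for [z] in the complement by skewness. *)
have lcww : levi_civita g w w = 0.
  apply: (form_inj g_pos) => z; rewrite levi_civitaE linear0l /koszul liexx.
  have [u [v [uU vU ->]]] := orthov_split g_pos U z.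
  have := skU v vU w wU w; rewrite (symm_formC g w) => skv.
  have gu := wperp _ _ uU wU.
  rewrite [{[w, _]}]lieC !linearDl /= linearNl linearDl /= linear0l gu.
  have -> : g {[v, w]} w = 0 by lra.
  lra.
(* Against [v] orthogonal to [U], the Koszul term in [{[x, w]}] vanishes because [U] is an ideal,
   and the other two cancel by [skU]. *)
have AU x : bismut_diff 0 w x \in U.
  suff: bismut_diff 0 w x \in orthov g (orthov g U).
    by rewrite (orthovK g_pos).
  apply/mem_orthovP => v vU; rewrite levi_civita_diffE levi_civitaE /koszul.
  rewrite [g {[x, w]} v]symm_formC (mem_orthov_form vU (idU _ _ wU)).
  rewrite [{[w, v]}]lieC linearNl /= skU // [g w _]symm_formC; ring.
have Asym : {in U &, forall x y, g (bismut_diff 0 w x) y =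
  1 * g x (bismut_diff 0 w y)}.
  move=> x y xU yU; rewrite mul1r [RHS]symm_formC !levi_civita_diffE
    !levi_civitaE.
  rewrite /koszul (wperp _ _ xU yU) (wperp _ _ yU xU).
  rewrite [{[w, y]}]lieC [{[w, x]}]lieC !linearNl /=; ring.
have hskew : {in fullv &, forall x y, g (torsion_op w x) y =
  -1 * g x (torsion_op w y)}.
  by move=> x y _ _; rewrite [g x _]symm_formC !torsion_opE threeformC13 mulN1r.
have [A_ge0 A_eq0] := lftrace_sqr g_pos AU Asym.
have [h_ge0 h_eq0] := lftrace_sqr g_pos (fun x => memvf _) hskew.
have := gnull w lcww; rewrite ricci_trace_diag => tr0.
have {}A_eq0 := A_eq0 ltac:(lra); have {}h_eq0 := h_eq0 ltac:(lra).
split=> [x y xU yU|x y].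
  have := congr1 (g^~ y) (A_eq0 x xU);
    rewrite /= levi_civita_diffE levi_civitaE linear0l.
  rewrite /koszul (wperp _ _ yU xU) [{[x, w]}]lieC linearNl /=
    [g {[w, y]} x]symm_formC; lra.
by rewrite threeformC12 -torsion_opE h_eq0 ?memvf // linear0l oppr0.
Qed.

(** * Induction along the derived series *)

Local Notation D := (derived_series L).

(** Reduces the induction step to vectors [w] of [D k] orthogonal to [D k.+1], the part [v'] being
    covered by the induction hypothesis. *)
Lemma orthov_derived_split k v : v \in orthov g (D k.+1) ->
  exists w v', [/\ w \in D k, w \in orthov g (D k.+1), v' \in orthov g (D k)
                 & v = w + v'].
Proof.
move=> vo; have [w [v' [wD v'o vE]]] := orthov_split g_pos (D k) v.
exists w, v'; split=> //; have -> : w = v - v' by rewrite vE addrK.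
rewrite rpredB //; apply/mem_orthovP => x xD.
by rewrite (mem_orthov_form v'o) // (subvP (derived_series_subS L k)).
Qed.

Lemma derived_series_skew k : geodesic_null ->
  skew_to (D k) /\ {in orthov g (D k), forall v x y, H v x y = 0}.
Proof.
move=> gnull; elim: k => [|k [skD HD]].
  have o0 v : v \in orthov g (D 0) -> v = 0.
    by move=> vo; apply/(form_eq0 g_pos)/(mem_orthov_form vo)/memvf.
  split=> [v /o0-> z _ y|v /o0-> x y].
    by rewrite !linear0l !linear0r oppr0.
  by have := threeform_linear1 H x y 1 0 0; rewrite scale1r addr0 mul1r; lra.
have core w :=
  geodesic_null_skew (w := w) gnull (@derived_series_ideal _ L k) skD.
have sub := subvP (derived_series_subS L k).
split=> [v /orthov_derived_split[w [v' [wD wo v'o ->]]] z zD y|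
         v /orthov_derived_split[w [v' [wD wo v'o ->]]] x y]; last first.
  have [_ Hw] := core w wD wo.
  by rewrite -[w]scale1r threeform_linear1 Hw HD // mulr0 addr0.
have [skw _] := core w wD wo.
rewrite [{[w + v', z]}]linearDl [{[w + v', y]}]linearDl linearDl linearDr /=.
rewrite (skD v' v'o _ (sub _ zD)) opprD; congr (_ + _).
(* [geodesic_null_skew] handles only [y1] in [D k]. For [y2] both sides vanish: [{[w, z]}] lies in
   [D k], and skewness of [y2] turns the right side into a product of [{[y2, z]}], in [D k.+1], with
   [w]. *)
have [y1 [y2 [y1D y2o ->]]] := orthov_split g_pos (D k) y.
rewrite [{[w, y1 + y2]}]linearDr !linearDr /= (skw _ _ (sub _ zD) y1D) opprD;
  congr (_ + _).
rewrite symm_formC (mem_orthov_form y2o) ?derived_series_ideal ?sub //.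
rewrite [{[w, y2]}]lieC linearNr /= opprK -[RHS]opprK -skD ?sub //.
by rewrite symm_formC (mem_orthov_form wo) ?oppr0 // derived_series_ideal.
Qed.

(** Skewness of [v] gives [g {[v, w]} {[v, w]} = - g {[v, {[v, w]}]} w], and this is zero since [w]
    is orthogonal to the ideal. *)
Lemma skew_to_commute U : lie_ideal U -> skew_to U ->
  {in orthov g U &, forall v w, {[v, w]} \in U -> {[v, w]} = 0}.
Proof.
move=> idU skU v w vo wo vwU; apply: (form_eq0 g_pos).
have := skU v vo _ vwU w.
by rewrite symm_formC (mem_orthov_form wo (idU _ _ vwU)); lra.
Qed.

(** With [x = {[p, q]}], [ad x] is the commutator of [ad p] and [ad q], and [ad q] commutes with
    [ad x]; cyclicity then cancels the two terms. *)
Lemma lftrace_ad_bracket (p q : L) : {[q, {[p, q]}]} = 0 ->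
  lftrace (ad {[p, q]} \o ad {[p, q]})%VF = 0.
Proof.
move=> qx0; set x := {[p, q]}.
have adx : ad x = ((ad p \o ad q) - (ad q \o ad p))%VF.
  apply/lfunP => z; rewrite add_lfunE opp_lfunE !comp_lfunE !adE.
  exact: lie_jacobi_ad.
have comm : (ad q \o ad x = ad x \o ad q)%VF.
  apply/lfunP => z; rewrite !comp_lfunE !adE; apply/esym/eqP.
  by rewrite -subr_eq0 -opprB oppr_eq0 -lie_jacobi_ad qx0 linear0l.
rewrite {1}adx comp_lfunDl comp_lfunNl linearB /= -!comp_lfunA comm.
by rewrite [X in _ - X]lftraceC -comp_lfunA subrr.
Qed.

(** The offset makes the descent stop at [D 2 = 0], which says that the derived algebra is
    abelian. *)
Lemma derived_series_step k : geodesic_null ->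
  D k.+3 = 0%VS -> D k.+2 = 0%VS.
Proof.
move=> gnull D30.
have [sk1 _] := derived_series_skew k.+1 gnull.
have [sk2 _] := derived_series_skew k.+2 gnull.
have id1 := @derived_series_ideal _ L k.+1.
have id2 := @derived_series_ideal _ L k.+2.
have ab x y : x \in D k.+2 -> y \in D k.+2 -> {[x, y]} = 0.
  by move=> xD yD; apply/eqP; rewrite -memv0 -D30 mem_derived_seriesS.
have sub2 := subvP (derived_series_subS L k.+1).
have sub1 := subvP (derived_series_subS L k).
(* Both [q] and [x = {[p, q]}] are orthogonal to [D k.+2], while [{[q, x]}] lies in it, so they
   commute. Then [ad x] is skew on [D k.+1] with square of trace zero, hence vanishes there. *)
have bracket_pq p q : p \in orthov g (D k.+1) -> q \in D k.+1 ->
    q \in orthov g (D k.+2) -> {in D k.+2, forall r, {[{[p, q]}, r]} = 0}.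
  move=> po qD qo r rD; set x := {[p, q]}.
  have xD : x \in D k.+1 by apply: id1.
  have xo : x \in orthov g (D k.+2).
    apply/mem_orthovP => y yD; rewrite (sk1 p po q qD).
    by rewrite (mem_orthov_form qo) ?oppr0 ?id2.
  have qx0 : {[q, x]} = 0.
    exact: (skew_to_commute id2 sk2 qo xo (mem_derived_seriesS qD xD)).
  have adD z : ad x z \in D k.+1 by rewrite adE lieC rpredN id1.
  have [skx _] := geodesic_null_skew gnull id1 sk1 xD xo.
  have adsk : {in D k.+1 &, forall y z, g (ad x y) z = -1 * g y (ad x z)}.
    by move=> y z yD zD; rewrite !adE skx // mulN1r.
  have [_ /(_ (lftrace_ad_bracket qx0) _ (sub2 _ rD))] :=
    lftrace_sqr g_pos adD adsk.
  by rewrite adE.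
(* Split [p] and [q] along [D k.+1]: [{[p1, q1]}] lies in the abelian [D k.+2], [{[p2, q2]}] is
   zero, and the mixed brackets reduce to [bracket_pq]. *)
have centr : {in D k.+2, forall r x, x \in D k.+1 -> {[r, x]} = 0}.
  move=> r rD; suff /subvP sub : (D k.+1 <= lker (ad r))%VS.
    by move=> x /sub; rewrite memv_ker adE => /eqP.
  apply/lieVP => p q pD qD; rewrite memv_ker adE.
  have [p1 [p2 [p1D p2o pE]]] := orthov_split g_pos (D k.+1) p.
  have [q1 [q2 [q1D q2o qE]]] := orthov_split g_pos (D k.+1) q.
  have p2D : p2 \in D k by rewrite -[p2](addKr p1) -pE addrC rpredB // sub1.
  have q2D : q2 \in D k by rewrite -[q2](addKr q1) -qE addrC rpredB // sub1.
  have mixed a b : a \in orthov g (D k.+1) -> b \in D k.+1 ->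
    {[r, {[a, b]}]} = 0.
    move=> ao bD; have [b1 [b2 [b1D b2o bE]]] := orthov_split g_pos (D k.+2) b.
    have b2D : b2 \in D k.+1 by rewrite -[b2](addKr b1) -bE addrC rpredB //
      sub2.
    rewrite bE linearDr linearDr /= ab ?id2 // add0r lieC.
    by rewrite (bracket_pq a b2) ?oppr0.
  have -> : {[p, q]} = {[p1, q1]} + {[p1, q2]} + {[p2, q1]}.
    rewrite pE qE linearDl !linearDr /=.
    by rewrite (skew_to_commute id1 sk1 p2o q2o) ?mem_derived_seriesS // addr0.
  rewrite !linearDr /= ab ?mem_derived_seriesS // add0r (mixed p2) // addr0.
  by rewrite [{[p1, q2]}]lieC linearNr /= mixed // oppr0.
apply/eqP; rewrite -subv0; apply/lieVP => x y xD yD.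
have [x1 [x2 [x1D x2o xE]]] := orthov_split g_pos (D k.+2) x.
have [y1 [y2 [y1D y2o yE]]] := orthov_split g_pos (D k.+2) y.
have x2D : x2 \in D k.+1 by rewrite -[x2](addKr x1) -xE addrC rpredB // sub2.
have y2D : y2 \in D k.+1 by rewrite -[y2](addKr y1) -yE addrC rpredB // sub2.
rewrite xE linearDl /= centr // add0r yE linearDr /= lieC centr // oppr0 add0r.
by rewrite (skew_to_commute id2 sk2) ?mem0v // mem_derived_seriesS.
Qed.

Lemma geodesic_null_structure : geodesic_null -> lie_solvable L ->
  [/\ forall x y z, H x y z = 0,
      lie_abelian (derived_algebra L),
      lie_abelian (orthov g (derived_algebra L))
    & acts_skew g (orthov g (derived_algebra L)) (derived_algebra L)].
Proof.
move=> gnull [n Dn0].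
have D20 : D 2 = 0%VS.
  (* The index is padded by two so that the descent also covers [n < 2]. *)
  have {Dn0} : D n.+2 = 0%VS.
    apply/eqP; rewrite -subv0 -Dn0.
    exact: subv_trans (derived_series_subS L n.+1) (derived_series_subS L n).
  by elim: n => // n IHn /derived_series_step; auto.
have [sk1 _] := derived_series_skew 1 gnull.
have id1 := @derived_series_ideal _ L 1.
split.
- have [_ H0] := derived_series_skew 2 gnull.
  by move=> x y z; rewrite H0 // D20 orthov0 memvf.
- by move=> x y xD yD; apply/eqP; rewrite -memv0 -D20 mem_derived_seriesS.
- by move=> x y xo yo; apply: (skew_to_commute id1 sk1) => //;
  rewrite mem_derived_seriesS ?memvf.
- by move=> x xo y z yD zD; apply: sk1.
Qed.

(** Makes the structure theorem available for flat metrics. Here [A] is [nabla z] and [N] is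
    [nabla_z]; the trace of [A^2] vanishes because [A^2] is a commutator. *)
Lemma flat_geodesic_null :
  (forall x y z, H x y z = 0) -> flat_metric g -> geodesic_null.
Proof.
move=> H0 flat z lczz; pose A := bismut_diff 0 z; pose N := A + ad z.
have AE y : A y = levi_civita g y z by apply: levi_civita_diffE.
have NE y : N y = levi_civita g z y.
  by rewrite add_lfunE AE adE -levi_civita_torsionfree addrC subrK.
have h0 : torsion_op z = 0.
  apply/lfunP => x; apply: (form_inj g_pos) => y.
  by rewrite torsion_opE H0 zero_lfunE linear0l.
rewrite ricci_trace_diag h0 comp_lfun0l linear0 mulr0 subr0 -/A.
(* Flatness of R(y, z)z says that A^2 = A N - N A. *)
have -> : (A \o A)%VF = ((A \o N) - (N \o A))%VF.
  apply/lfunP => y; rewrite add_lfunE opp_lfunE !comp_lfunE.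
  have lc0 : levi_civita g y 0 = 0.
    by apply: (form_inj g_pos) => x; rewrite levi_civita_metric !linear0l oppr0.
  have := flat y z z; rewrite /curvature lczz lc0 -levi_civita_torsionfree.
  rewrite -!AE -!NE linearB /= => /eqP.
  by rewrite sub0r -opprD oppr_eq0 addrCA addr_eq0 opprB => /eqP.
by rewrite linearB /= (lftraceC N A) subrr.
Qed.

(** * The generalised Ricci curvatures *)

(** Elements of the eigenspaces are determined by their vector parts, so the later computations
    concern first components only. *)
Lemma val_pi_plus a : vsval (pi_plus g a) = embp_fun g (proj_plus g a).1.
Proof.
have mem := proj_plus_mem a pos_nondegenerate.
rewrite vsprojK //; move/(EplusP _ pos_nondegenerate)/(congr1 snd): mem.
by rewrite gmetricE /embp_fun /= => ->; case: (proj_plus g a).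
Qed.

Lemma val_pi_minus a : vsval (pi_minus g a) = embm_fun g (proj_minus g a).1.
Proof.
have mem := proj_minus_mem a pos_nondegenerate.
rewrite vsprojK //; move/(EminusP _ pos_nondegenerate)/(congr1 snd): mem.
by rewrite gmetricE /embm_fun /= => ->; rewrite opprK; case: (proj_minus g a).
Qed.

Lemma val_Eplus (u : subvs_of (Eplus g)) : vsval u = embp_fun g (vsval u).1.
Proof. by have /memv_imgP[x _ ->] := subvsP u; rewrite lfunE. Qed.

Lemma val_Eminus (v : subvs_of (Eminus g)) : vsval v = embm_fun g (vsval v).1.
Proof. by have /memv_imgP[x _ ->] := subvsP v; rewrite lfunE. Qed.

Lemma proj_plus_fst a : (proj_plus g a).1 = 2^-1 *: (a.1 + gsharp g a.2).
Proof. by rewrite scale_lfunE add_lfunE id_lfunE gmetricE. Qed.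

Lemma proj_minus_fst a : (proj_minus g a).1 = 2^-1 *: (a.1 - gsharp g a.2).
Proof. by rewrite scale_lfunE add_lfunE opp_lfunE id_lfunE gmetricE. Qed.

Lemma dorfman_sndE a b x : (dorfman H a b).2 x =
  - b.2 {[a.1, x]} + a.2 {[b.1, x]} + H a.1 b.1 x.
Proof. by rewrite /dorfman /= !add_lfunE opp_lfunE !lfunE /= /ce_d1 opprK. Qed.

Lemma proj_plus_dorfmanE a b x : g (proj_plus g (dorfman H a b)).1 x =
  2^-1 * (g {[a.1, b.1]} x - b.2 {[a.1, x]} + a.2 {[b.1, x]} + H a.1 b.1 x).
Proof.
by rewrite proj_plus_fst linearZl linearDl /= gsharpE dorfman_sndE !addrA.
Qed.

Lemma proj_minus_dorfmanE a b x : g (proj_minus g (dorfman H a b)).1 x =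
  2^-1 * (g {[a.1, b.1]} x + b.2 {[a.1, x]} - a.2 {[b.1, x]} - H a.1 b.1 x).
Proof.
by rewrite proj_minus_fst linearZl linearBl /= gsharpE dorfman_sndE; ring.
Qed.

(** Projected mixed Dorfman brackets are the connections with torsion: [proj_plus] gives [c = 1/2],
    differentiating along the [Eminus] argument, and [proj_minus] gives [c = -1/2], along the
    [Eplus] one. Exchanging the arguments changes the sign. *)
Lemma proj_plus_dorfman_mp x y :
  (proj_plus g (dorfman H (embm_fun g y) (embp_fun g x))).1 = bismut 2^-1 y x.
Proof.
apply: (form_inj g_pos) => z; rewrite proj_plus_dorfmanE bismutE /=.
rewrite opp_lfunE !gflatE /koszul (symm_formC g x) (symm_formC g y).
by rewrite [{[z, y]}]lieC linearNl /=; ring.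
Qed.

Lemma proj_plus_dorfman_pm x y :
  (proj_plus g (dorfman H (embp_fun g x) (embm_fun g y))).1 = - bismut 2^-1 y x.
Proof.
apply: (form_inj g_pos) => z; rewrite proj_plus_dorfmanE linearNl /= bismutE.
rewrite opp_lfunE !gflatE /koszul (symm_formC g x) (symm_formC g y).
rewrite [{[z, y]}]lieC [{[y, x]}]lieC !linearNl /= (threeformC12 y x); ring.
Qed.

Lemma proj_minus_dorfman_pm x y :
  (proj_minus g (dorfman H (embp_fun g x) (embm_fun g y))).1
    = bismut (- 2^-1) x y.
Proof.
apply: (form_inj g_pos) => z; rewrite proj_minus_dorfmanE bismutE /=.
rewrite opp_lfunE !gflatE /koszul (symm_formC g x) (symm_formC g y).
by rewrite [{[z, x]}]lieC linearNl /=; ring.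
Qed.

Lemma proj_minus_dorfman_mp x y :
  (proj_minus g (dorfman H (embm_fun g y) (embp_fun g x))).1
    = - bismut (- 2^-1) x y.
Proof.
apply: (form_inj g_pos) => z; rewrite proj_minus_dorfmanE linearNl /= bismutE.
rewrite opp_lfunE !gflatE /koszul (symm_formC g x) (symm_formC g y).
rewrite [{[z, x]}]lieC [{[y, x]}]lieC !linearNl /= (threeformC12 y x); ring.
Qed.

(** Cyclicity carries the trace from [Eminus] to [L] along the isomorphism [emb] with inverse [pr].
    The minus signs of the two [Gamma] maps cancel. *)
Lemma lftrace_Gamma (u : subvs_of (Eplus g)) (v : subvs_of (Eminus g)) :
  lftrace (Gamma_minus H v \o Gamma_plus H u)%VF
    = ricci_trace (vsval u).1 (vsval v).1.
Proof.
pose emb : 'Hom(L, subvs_of (Eminus g)) :=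
  (linfun (vsproj (Eminus g)) \o linfun (embm_fun g))%VF.
pose pr : 'Hom(subvs_of (Eminus g), L) := (linfun fst \o linfun vsval)%VF.
have prE (w : subvs_of _) : pr w = (vsval w).1 by rewrite comp_lfunE !lfunE.
have embE x : vsval (emb x) = embm_fun g x.
  rewrite comp_lfunE !lfunE /= vsprojK //; apply/memv_imgP.
  by exists x; rewrite ?memvf ?lfunE.
have embK (w : subvs_of _) : emb (pr w) = w by apply: val_inj;
  rewrite /= embE prE -val_Eminus.
clearbody emb pr.
have -> : (Gamma_minus H v \o Gamma_plus H u)%VF =
          (((Gamma_minus H v \o Gamma_plus H u) \o emb) \o pr)%VF.
  by apply/lfunP => w; rewrite [RHS]comp_lfunE [RHS]comp_lfunE embK.
rewrite lftraceC; congr lftrace; apply/lfunP => x; rewrite !comp_lfunE prE.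
rewrite !lfunE /= /Gamma_minus_fun /Gamma_plus_fun.
rewrite val_pi_minus /= val_pi_plus embE (val_Eplus u) (val_Eminus v).
rewrite proj_plus_dorfman_pm proj_minus_dorfman_mp.
by rewrite -[X in - X = _]/(bismut_diff_fun _ _ _) linearN opprK.
Qed.

Lemma generalised_einsteinE (delta : dual R (courant L)) :
  generalised_einstein H g delta <-> forall x y,
    ricci_trace x y = delta (embp_fun g (bismut 2^-1 y x)) /\
    ricci_trace x y = delta (embm_fun g (bismut (- 2^-1) x y)).
Proof.
have ricE (t d : R) : - t + d = 0 <-> t = d.
  by rewrite addrC; split=> [/eqP|->]; rewrite ?subrr // subr_eq0 => /eqP.
have ricpE (u : subvs_of (Eplus g)) (v : subvs_of (Eminus g)) :
    ricci_plus H delta v u = 0 <->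
    ricci_trace (vsval u).1 (vsval v).1
      = delta (embp_fun g (bismut 2^-1 (vsval v).1 (vsval u).1)).
  rewrite /ricci_plus lftrace_Gamma val_pi_plus -proj_plus_dorfman_mp.
  by rewrite -val_Eplus -val_Eminus ricE.
have ricmE (u : subvs_of (Eplus g)) (v : subvs_of (Eminus g)) :
    ricci_minus H delta u v = 0 <->
    ricci_trace (vsval u).1 (vsval v).1
      = delta (embm_fun g (bismut (- 2^-1) (vsval u).1 (vsval v).1)).
  rewrite /ricci_minus lftrace_Gamma val_pi_minus -proj_minus_dorfman_pm.
  by rewrite -val_Eplus -val_Eminus ricE.
split=> [[ricp ricm] x y|eqT]; last first.
  by split=> [v u|u v]; [apply/ricpE | apply/ricmE];
    have [] := eqT (vsval u).1 (vsval v).1.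
have xE : vsval (vsproj (Eplus g) (embp_fun g x)) = embp_fun g x.
  by rewrite vsprojK //; apply/memv_imgP; exists x; rewrite ?memvf ?lfunE.
have yE : vsval (vsproj (Eminus g) (embm_fun g y)) = embm_fun g y.
  by rewrite vsprojK //; apply/memv_imgP; exists y; rewrite ?memvf ?lfunE.
have /ricpE := ricp (vsproj _ (embm_fun g y)) (vsproj _ (embp_fun g x)).
have /ricmE := ricm (vsproj _ (embp_fun g x)) (vsproj _ (embm_fun g y)).
by rewrite xE yE.
Qed.

(** On the diagonal the torsion term [H z z] vanishes, so [delta] is evaluated at zero. *)
Lemma einstein_geodesic_null delta :
  generalised_einstein H g delta -> geodesic_null.
Proof.
move=> /generalised_einsteinE einst z lczz; have [-> _] := einst z z.
suff -> : bismut 2^-1 z z = 0 by rewrite !linear0.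
apply: (form_inj g_pos) => x; rewrite bismutE -levi_civitaE lczz !linear0l.
by rewrite threeform_alt12 mulr0 addr0.
Qed.

(** * The flat structure *)

Section FlatStructure.
Local Notation n := (derived_algebra L).
Hypothesis H0 : forall x y z, H x y z = 0.
Hypothesis n_abelian : lie_abelian n.
Hypothesis h_abelian : lie_abelian (orthov g n).
Hypothesis h_skew : acts_skew g (orthov g n) n.

Lemma mem_derived x y : {[x, y]} \in n.
Proof. by rewrite mem_lieV ?memvf. Qed.

(** Extends [h_skew] to all of [L]: [ad x] kills the complement of [n] and has image in [n]. *)
Lemma orthov_derived_skew x y z :
  x \in orthov g n -> g {[x, y]} z = - g y {[x, z]}.
Proof.
move=> xo; have [y1 [y2 [y1n y2o ->]]] := orthov_split g_pos n y.
have [z1 [z2 [z1n z2o ->]]] := orthov_split g_pos n z.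
rewrite [{[x, y1 + y2]}]linearDr [{[x, z1 + z2]}]linearDr /=.
rewrite (h_abelian xo y2o) (h_abelian xo z2o) !addr0 linearDr linearDl /=.
rewrite [g _ z2]symm_formC (mem_orthov_form z2o (mem_derived _ _)).
by rewrite (mem_orthov_form y2o (mem_derived _ _)) !addr0 h_skew.
Qed.

Lemma levi_civita_orthov x y : x \in orthov g n -> levi_civita g x y = {[x, y]}.
Proof.
move=> xo; apply: (form_inj g_pos) => z; rewrite levi_civitaE /koszul.
rewrite [g _ x]symm_formC (mem_orthov_form xo (mem_derived _ _)).
rewrite [{[z, x]}]lieC linearNl /= (orthov_derived_skew z y xo).
rewrite [g z _]symm_formC; lra.
Qed.

Lemma levi_civita_derived x y : x \in n -> levi_civita g x y = 0.
Proof.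
move=> xn; apply: (form_inj g_pos) => z; rewrite levi_civitaE linear0l.
have [y1 [y2 [y1n y2o ->]]] := orthov_split g_pos n y.
have [z1 [z2 [z1n z2o ->]]] := orthov_split g_pos n z.
rewrite /koszul !(linearDl, linearDr) /= (n_abelian xn y1n) (n_abelian y1n z1n).
rewrite (n_abelian z1n xn) (h_abelian y2o z2o) !linear0l.
rewrite [g _ z2]symm_formC (mem_orthov_form z2o (mem_derived _ _)).
rewrite [g _ y2]symm_formC (mem_orthov_form y2o (mem_derived _ _)).
rewrite [{[x, y2]}]lieC [{[y1, z2]}]lieC !linearNl /=.
rewrite (orthov_derived_skew x z1 y2o) (orthov_derived_skew y1 x z2o).
by rewrite (symm_formC g x) (symm_formC g y1); ring.
Qed.

Lemma levi_civitaDl u v y :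
  levi_civita g (u + v) y = levi_civita g u y + levi_civita g v y.
Proof.
apply: (form_inj g_pos) => z; rewrite linearDl /= !levi_civitaE /koszul.
by rewrite !(linearDl, linearDr) /=; ring.
Qed.

Lemma levi_civita_split u v y : u \in n -> v \in orthov g n ->
  levi_civita g (u + v) y = {[v, y]}.
Proof.
by move=> un vo; rewrite levi_civitaDl levi_civita_derived // add0r
  levi_civita_orthov.
Qed.

Lemma levi_civita_mem x y : levi_civita g x y \in n.
Proof.
have [x1 [x2 [x1n x2o ->]]] := orthov_split g_pos n x.
by rewrite levi_civita_split ?mem_derived.
Qed.

(** As [nabla_x] is the adjoint action of the component of [x] orthogonal to [n], the curvature is
    the adjoint action of a bracket in the abelian complement. *)
Lemma structure_flat : flat_metric g.
Proof.
move=> x y z; rewrite /curvature (levi_civita_derived z (mem_derived x y))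
  subr0.
have [x1 [x2 [x1n x2o ->]]] := orthov_split g_pos n x.
have [y1 [y2 [y1n y2o ->]]] := orthov_split g_pos n y.
rewrite !(levi_civita_split _ x1n x2o) !(levi_civita_split _ y1n y2o).
by rewrite -lie_jacobi_ad (h_abelian x2o y2o) linear0l.
Qed.

Lemma bismut_structure c x y : bismut c x y = levi_civita g x y.
Proof.
apply: (form_inj g_pos) => z.
by rewrite bismutE H0 mulr0 addr0 levi_civitaE.
Qed.

(** Already the composite vanishes: [nabla_z x] lies in [n], and [nabla] along [n] is zero. *)
Lemma ricci_trace_structure x y : ricci_trace x y = 0.
Proof.
rewrite /ricci_trace;
  suff -> : (bismut_diff (- 2^-1) y \o bismut_diff 2^-1 x)%VF = 0.
  exact: linear0.
apply/lfunP => z; rewrite comp_lfunE zero_lfunE !bismut_diffE !bismut_structure.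
by rewrite levi_civita_derived ?levi_civita_mem.
Qed.

Lemma structure_einstein (delta : dual R (courant L)) :
  generalised_einstein H g delta <->
  {in n &, forall x y, delta (x, gflat g y) = 0}.
Proof.
split=> [/generalised_einsteinE einst|delta0]; last first.
  apply/generalised_einsteinE => x y.
  rewrite ricci_trace_structure !bismut_structure /embp_fun /embm_fun -linearN
    /=.
  by rewrite !delta0 ?rpredN ?levi_civita_mem.
(* Brackets are differences of values of [nabla], which is torsion-free, and they span [n]. *)
have vanish (emb : {linear L -> courant L}) :
    (forall x y, delta (emb (levi_civita g x y)) = 0) ->
  {in n, forall x, delta (emb x) = 0}.
  move=> emb0; suff /subvP sub : (n <= lker (delta \o linfun emb)%VF)%VS.
    by move=> x /sub; rewrite memv_ker comp_lfunE lfunE => /eqP.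
  apply/lieVP => x y _ _; rewrite memv_ker comp_lfunE lfunE /=.
  by rewrite -levi_civita_torsionfree !linearB /= !emb0 subrr.
have embp0 : {in n, forall x, delta (embp_fun g x) = 0}.
  apply: vanish => x y; have [] := einst y x.
  by rewrite ricci_trace_structure bismut_structure.
have embm0 : {in n, forall x, delta (embm_fun g x) = 0}.
  apply: vanish => x y; have [_] := einst x y.
  by rewrite ricci_trace_structure bismut_structure.
have half (V : lmodType R) (a b : V) : 2^-1 *: (a + b + (a - b)) = a.
  rewrite addrACA subrr addr0 -mulr2n -scaler_nat scalerA.
  by rewrite mulVf ?pnatr_eq0 ?scale1r.
(* Splits [x + gflat y] into its [Eplus] and [Eminus] parts, with vectors [(x + y)/2] and
   [(x - y)/2]. *)
move=> x y xn yn; have -> : (x, gflat g y) =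
    2^-1 *: (embp_fun g (x + y) + embm_fun g (x - y)) :> courant L.
  congr pair; rewrite /= ?half // (linearD (gflat g)) (linearB (gflat g)) /=
    opprB.
  by rewrite [gflat g x + _]addrC half.
by rewrite linearZ linearD /= embp0 ?embm0 ?rpredD ?rpredN // addr0 scaler0.
Qed.

End FlatStructure.

End Connections.

Theorem corollary3p3 (R : realType) (L : lieAlgebraType R)
    (H : threeForm L) (g : {symmetric L}) (delta : dual R (courant L))
    (Hg : generalised_riemannian H g) (L_solvable : lie_solvable L) :
  (generalised_einstein H g delta <->
     [/\ forall x y z, H x y z = 0,
         lie_abelian (derived_algebra L) /\ lie_ideal (derived_algebra L),
         lie_abelian (orthov g (derived_algebra L)) /\
           lie_subalgebra (orthov g (derived_algebra L)),
         acts_skew g (orthov g (derived_algebra L)) (derived_algebra L)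
       & {in derived_algebra L &, forall x y, delta (x, gflat g y) = 0}])
  /\
  (generalised_einstein H g delta <->
     [/\ forall x y z, H x y z = 0,
         flat_metric g
       & {in derived_algebra L &, forall x y, delta (x, gflat g y) = 0}]).
Proof.
have [_ g_pos] := Hg; split; split.
- move=> einst; have gnull := einstein_geodesic_null g_pos einst.
  have [H0 nab hab hskew] := geodesic_null_structure g_pos gnull L_solvable.
  split=> //; last by apply/(structure_einstein g_pos H0 nab hab hskew).
    by split=> // x y _; apply: mem_derived.
  by split=> // x y xo yo; rewrite hab ?mem0v.
- by case=> H0 [nab _] [hab _] hskew /(structure_einstein g_pos H0 nab hab
  hskew).
- move=> einst; have gnull := einstein_geodesic_null g_pos einst.
  have [H0 nab hab hskew] := geodesic_null_structure g_pos gnull L_solvable.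
  split=> //; first exact: (structure_flat g_pos nab hab hskew).
  by apply/(structure_einstein g_pos H0 nab hab hskew).
(* The algebraic structure is recovered from flatness through [geodesic_null], as in the Einstein
   case. *)
case=> H0 flat; have gnull := flat_geodesic_null g_pos H0 flat.
have [_ nab hab hskew] := geodesic_null_structure g_pos gnull L_solvable.
by move/(structure_einstein g_pos H0 nab hab hskew).
Qed.
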